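(* Let $m\in\mathbb N$ and let $d$ be a pseudometric on $\mathbb Z$. Let $f:\mathbb Z\to\mathbb R_{\ge 0}$ with $f(1)=0$ be such that $d(x,y)=f(x)+f(y)$ for all $x,y\in\mathbb Z$ with $x\ne y$. Let $\mathbf x=(x_i)_{i=0}^{m-1},\ \mathbf y=(y_i)_{i=0}^{m-1}\in\mathbb Z^m$ be such that either $x_i=y_i$ for all $0\le i\le m-1$, or $x_i\ne y_i$ for all $0\le i\le m-1$. Then (1) $d^{(m)}_{AM}(\mathbf x,\mathbf y)=D^{(m,+)}_f(\mathbf x,\mathbf y)$, (2) $d^{(m)}_{GM}(\mathbf x,\mathbf y)\ge D^{(m,\cdot)}_f(\mathbf x,\mathbf y)$, (3) $d^{(m)}_{HM}(\mathbf x,\mathbf y)\ge D^{(m,h)}_f(\mathbf x,\mathbf y)$, and moreover, writing $\mathbf 1=(1,\dots,1)\in\mathbb Z^m$, (4) $d^{(m)}_{AM}(\mathbf 1,\mathbf x)\le d^{(m)}_{AM}(\mathbf 1,\mathbf y)\iff f^{(m,+)}(\mathbf x)\le f^{(m,+)}(\mathbf y)$, (5) $d^{(m)}_{GM}(\mathbf 1,\mathbf x)\le d^{(m)}_{GM}(\mathbf 1,\mathbf y)\iff f^{(m,\cdot)}(\mathbf x)\le f^{(m,\cdot)}(\mathbf y)$, (6) $d^{(m)}_{HM}(\mathbf 1,\mathbf x)\le d^{(m)}_{HM}(\mathbf 1,\mathbf y)\iff f^{(m,h)}(\mathbf x)\le f^{(m,h)}(\mathbf y)$.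
   Context: For $\mathbf x,\mathbf y\in\mathbb Z^m$: $d^{(m)}_{AM}(\mathbf x,\mathbf y)=\frac1m\sum_{i=0}^{m-1}d(x_i,y_i)$; $d^{(m)}_{GM}(\mathbf x,\mathbf y)=\big(\prod_{i=0}^{m-1}d(x_i,y_i)\big)^{1/m}$; $d^{(m)}_{HM}(\mathbf x,\mathbf y)=m/\sum_{i=0}^{m-1}\frac1{d(x_i,y_i)}$ if $d(x_i,y_i)>0$ for all $i$, and $0$ otherwise. For $f:\mathbb Z\to\mathbb R_{\ge0}$ and $\mathbf x\in\mathbb Z^m$: $f^{(m,+)}(\mathbf x)=\frac1m\sum_{i=0}^{m-1}f(x_i)$; $f^{(m,\cdot)}(\mathbf x)=\big(\prod_{i=0}^{m-1}f(x_i)\big)^{1/m}$; $f^{(m,h)}(\mathbf x)=m/\sum_{i=0}^{m-1}\frac1{f(x_i)}$ if $f(x_i)>0$ for all $i$, and $0$ otherwise. For $\star\in\{+,\cdot,h\}$, $D^{(m,\star)}_f(\mathbf x,\mathbf y)=f^{(m,\star)}(\mathbf x)+f^{(m,\star)}(\mathbf y)$ if $\mathbf x\ne\mathbf y$, and $D^{(m,\star)}_f(\mathbf x,\mathbf x)=0$. *)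

(* Defs.v *)
From mathcomp Require Import all_boot all_order all_algebra.
From mathcomp Require Import reals exp.

Set Implicit Arguments.
Unset Strict Implicit.
Unset Printing Implicit Defensive.

Import Order.TTheory GRing.Theory Num.Theory.
Local Open Scope ring_scope.

(* The library's [pseudoMetricType] is presented by balls and does not carry a
   distance function, hence this definition. *)
Record is_pseudometric (R : realType) (T : Type) (d : T -> T -> R) : Prop :=
  IsPseudometric {
    pseudometric_ge0 : forall x y, 0 <= d x y;
    pseudometric_xx : forall x, d x x = 0;
    pseudometric_sym : forall x y, d x y = d y x;
    pseudometric_triangle : forall x y z, d x z <= d x y + d y z
  }.

Section Means.
Context {R : realType} {m : nat}.
Implicit Type a : 'I_m -> R.

Definition arith_mean a : R := m%:R^-1 * \sum_(i < m) a i.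

(* On a nonnegative base, [powR] with exponent 1/m is the usual m-th root for
   m > 0; in particular it maps 0 to 0. *)
Definition geom_mean a : R := powR (\prod_(i < m) a i) m%:R^-1.

Definition harm_mean a : R :=
  if [forall i, 0 < a i] then m%:R / \sum_(i < m) (a i)^-1 else 0.

End Means.

Section Vectors.
Context {R : realType} {m : nat}.
Implicit Types (d : int -> int -> R) (f : int -> R) (x y : 'rV[int]_m).

Definition dAM d x y : R := arith_mean (fun i => d (x 0 i) (y 0 i)).
Definition dGM d x y : R := geom_mean (fun i => d (x 0 i) (y 0 i)).
Definition dHM d x y : R := harm_mean (fun i => d (x 0 i) (y 0 i)).

Definition f_add f x : R := arith_mean (fun i => f (x 0 i)).
Definition f_mul f x : R := geom_mean (fun i => f (x 0 i)).
Definition f_harm f x : R := harm_mean (fun i => f (x 0 i)).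

(* [F] stands for any of [f_add f], [f_mul f], [f_harm f]. *)
Definition D_of (F : 'rV[int]_m -> R) x y : R :=
  if x == y then 0 else F x + F y.

End Vectors.

(* Main.v *)
(* Whenever f 1 = 0, d 1 a = f a for every a, so the last three equivalences are
   equalities of means. For coordinatewise distinct vectors, d is the sum of
   the two f-vectors, so the first three claims are the additivity of the
   arithmetic mean and the superadditivity of the geometric and harmonic ones.
   The geometric case (Mahler's inequality) is AM-GM applied to a / (a + b)
   and b / (a + b). The harmonic case sums over i the Cauchy-Schwarz bound
     1 / (a i + b i) <= t^2 / a i + (1 - t)^2 / b i
   for the t that minimises the sum of the right-hand sides. *)
Require Import Defs.
From mathcomp Require Import all_boot all_order all_algebra.
From mathcomp Require Import reals exp.
From mathcomp Require Import ring.

Import Order.TTheory GRing.Theory Num.Theory.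
Local Open Scope ring_scope.

Section Means.
Set Implicit Arguments.
Unset Strict Implicit.
Variables (R : realType) (m : nat).
Hypothesis m_gt0 : (0 < m)%N.
Implicit Types a b : 'I_m -> R.

Lemma eq_arith_mean a b : a =1 b -> arith_mean a = arith_mean b.
Proof. by move=> ab; rewrite /arith_mean (eq_bigr b). Qed.

Lemma eq_geom_mean a b : a =1 b -> geom_mean a = geom_mean b.
Proof. by move=> ab; rewrite /geom_mean (eq_bigr b). Qed.

Lemma eq_harm_mean a b : a =1 b -> harm_mean a = harm_mean b.
Proof.
move=> ab; rewrite /harm_mean (eq_forallb (P2 := fun i => 0 < b i)); last first.
  by move=> i; rewrite ab.
by under eq_bigr do rewrite ab.
Qed.

Lemma arith_meanD a b :
  arith_mean (fun i => a i + b i) = arith_mean a + arith_mean b.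
Proof. by rewrite /arith_mean big_split mulrDr. Qed.

Lemma arith_mean_cst (c : R) : arith_mean (fun _ : 'I_m => c) = c.
Proof.
rewrite /arith_mean sumr_const card_ord -[c *+ m]mulr_natl mulKf //.
by rewrite pnatr_eq0 -lt0n.
Qed.

Lemma geom_mean_cst0 : geom_mean (fun _ : 'I_m => 0 : R) = 0.
Proof.
by rewrite /geom_mean prodr_const card_ord expr0n eqn0Ngt m_gt0 powR0 // invr_eq0
  pnatr_eq0 -lt0n.
Qed.

Lemma harm_mean_cst0 : harm_mean (fun _ : 'I_m => 0 : R) = 0.
Proof.
rewrite /harm_mean; case: forallP => // /(_ (Ordinal m_gt0)).
by rewrite ltxx.
Qed.

Lemma geom_mean_ge0 a : 0 <= geom_mean a.
Proof. exact: powR_ge0. Qed.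

Lemma harm_meanE a :
  (forall i, 0 < a i) -> harm_mean a = m%:R / \sum_(i < m) (a i)^-1.
Proof. by move=> a0; rewrite /harm_mean; case: forallP. Qed.

Lemma geom_meanM a b : (forall i, 0 <= a i) -> (forall i, 0 <= b i) ->
  geom_mean (fun i => a i * b i) = geom_mean a * geom_mean b.
Proof.
by move=> a0 b0; rewrite /geom_mean big_split powRM // prodr_ge0.
Qed.

Lemma geom_mean_eq0 a i : a i = 0 -> geom_mean a = 0.
Proof.
(* [powR 0 0] is 1, so [powR0] needs the exponent [m%:R^-1] to be nonzero. *)
move=> ai0; rewrite /geom_mean (bigD1 i) //= ai0 mul0r powR0 //.
by rewrite invr_eq0 pnatr_eq0 -lt0n.
Qed.

Lemma geom_mean_le_arith a : (forall i, 0 <= a i) -> geom_mean a <= arith_mean a.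
Proof.
move=> a0; have am0 : 0 <= arith_mean a.
  by rewrite /arith_mean mulr_ge0 ?invr_ge0 ?sumr_ge0.
have mN0 : m%:R != 0 :> R by rewrite pnatr_eq0 -lt0n.
have agm : \prod_(i < m) a i <= arith_mean a ^+ m.
  have [+ _] := @leif_AGM _ _ (mem 'I_m) a (fun i _ => a0 i).
  by rewrite card_ord /arith_mean mulrC.
(* The right side becomes the [m]-th root of its own [m]-th power, so monotonicity of the root
   reduces the goal to [agm]. *)
rewrite -[leRHS](powRr1 am0) -(divff mN0) powRrM powR_mulrn //.
by rewrite ge0_ler_powR ?nnegrE ?invr_ge0 ?prodr_ge0 ?exprn_ge0.
Qed.

Lemma geom_mean_superadd a b : (forall i, 0 <= a i) -> (forall i, 0 <= b i) ->
  geom_mean a + geom_mean b <= geom_mean (fun i => a i + b i).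
Proof.
(* A vanishing [a i + b i] forces [a i = b i = 0], and both means on the left are 0; otherwise
   division by the sums is allowed. *)
move=> a0 b0; have [/existsP[i /eqP abi0]|] := boolP [exists i, a i + b i == 0].
  have /andP[/eqP ai0 /eqP bi0] : (a i == 0) && (b i == 0).
    by rewrite -paddr_eq0 // abi0.
  by rewrite (geom_mean_eq0 ai0) (geom_mean_eq0 bi0) addr0 geom_mean_ge0.
rewrite negb_exists => /forallP sN0.
pose s i := a i + b i.
have s0 i : 0 <= s i by rewrite addr_ge0.
(* Multiplicativity factors [s] out of [c]; AM-GM then bounds the mean of the ratios [c i / s i]. *)
have split_s c : (forall i, 0 <= c i) ->
    geom_mean c <= geom_mean s * arith_mean (fun i => c i / s i).
  move=> c0; have cs0 i : 0 <= c i / s i by rewrite divr_ge0.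
  rewrite (@eq_geom_mean c (fun i => s i * (c i / s i))); last first.
    by move=> i; rewrite mulrC divfK // sN0.
  by rewrite geom_meanM // ler_wpM2l ?geom_mean_ge0 ?geom_mean_le_arith.
apply: le_trans (lerD (split_s a a0) (split_s b b0)) _.
rewrite -mulrDr -arith_meanD (@eq_arith_mean _ (fun=> 1)); last first.
  by move=> i; rewrite -mulrDl divff // sN0.
by rewrite arith_mean_cst mulr1.
Qed.

Lemma sumr_inv_gt0 a : (forall i, 0 < a i) -> 0 < \sum_(i < m) (a i)^-1.
Proof.
move=> a0; rewrite (bigD1 (Ordinal m_gt0)) //= ltr_wpDr ?invr_gt0 //.
by rewrite sumr_ge0 // => i _; rewrite invr_ge0 ltW.
Qed.

Lemma harm_mean_ge0 a : 0 <= harm_mean a.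
Proof.
rewrite /harm_mean; case: forallP => // a0.
by rewrite divr_ge0 // ltW // sumr_inv_gt0.
Qed.

(** If some [a i] is not positive, the left side is the default 0. Superadditivity uses this when
    one of its two means is that default. *)
Lemma le_harm_mean a b : (forall i, a i <= b i) -> harm_mean a <= harm_mean b.
Proof.
move=> ab; rewrite {1}/harm_mean; case: forallP => [a0|_]; last first.
  exact: harm_mean_ge0.
have b0 i : 0 < b i by exact: lt_le_trans (ab i).
rewrite harm_meanE // ler_wpM2l // lef_pV2 ?posrE ?sumr_inv_gt0 //.
by apply: ler_sum => i _; rewrite lef_pV2 ?posrE.
Qed.

(** The difference of the two sides is a square over a positive denominator. As [t] is free, one
    value can serve all indices at once. *)
Lemma invrD_le_sq (u v t : R) : 0 < u -> 0 < v ->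
  (u + v)^-1 <= t ^+ 2 * u^-1 + (1 - t) ^+ 2 * v^-1.
Proof.
move=> u0 v0; have uv0 : 0 < u + v by rewrite addr_gt0.
have [uN vN wN] : [/\ u != 0, v != 0 & u + v != 0] by rewrite !gt_eqF.
rewrite -subr_ge0.
have -> : t ^+ 2 * u^-1 + (1 - t) ^+ 2 * v^-1 - (u + v)^-1 =
    (t * v - (1 - t) * u) ^+ 2 / (u * v * (u + v)).
  by field; rewrite uN vN wN.
by rewrite divr_ge0 ?sqr_ge0 // ltW // !mulr_gt0.
Qed.

Lemma harm_mean_superadd a b : (forall i, 0 <= a i) -> (forall i, 0 <= b i) ->
  harm_mean a + harm_mean b <= harm_mean (fun i => a i + b i).
Proof.
move=> age0 bge0; rewrite {1}/harm_mean.
case: forallP => [a0|_]; last by rewrite add0r le_harm_mean // => i; rewrite lerDr.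
rewrite {1}/harm_mean; case: forallP => [b0|_]; last first.
  by rewrite addr0 -harm_meanE // le_harm_mean // => i; rewrite lerDl.
have ab0 i : 0 < a i + b i by rewrite addr_gt0.
rewrite harm_meanE // -mulrDr ler_wpM2l //.
set A := \sum_i (a i)^-1; set B := \sum_i (b i)^-1; set C := \sum_i _.
have [A0 B0 C0] : [/\ 0 < A, 0 < B & 0 < C] by rewrite !sumr_inv_gt0.
have [AN BN SN] : [/\ A != 0, B != 0 & A + B != 0] by rewrite !gt_eqF ?addr_gt0.
(* The minimiser of [t ^+ 2 * A + (1 - t) ^+ 2 * B], with minimum [A * B / (A + B)]. *)
pose t := B / (A + B).
have CAB : C <= A * B / (A + B).
  have -> : A * B / (A + B) = t ^+ 2 * A + (1 - t) ^+ 2 * B.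
    by rewrite /t; field; rewrite SN.
  rewrite /A /B !mulr_sumr -big_split; apply: ler_sum => i _.
  exact: invrD_le_sq.
have -> : A^-1 + B^-1 = (A * B / (A + B))^-1 by field; rewrite AN BN SN.
by rewrite lef_pV2 ?posrE // (lt_le_trans C0).
Qed.

End Means.

Theorem theorem2p9 (R : realType) (m : nat) (m_gt0 : (0 < m)%N)
  (d : int -> int -> R) (d_pseudo : is_pseudometric d)
  (f : int -> R) (f_ge0 : forall n : int, 0 <= f n) (f1 : f 1 = 0)
  (dE : forall a b : int, a <> b -> d a b = f a + f b)
  (x y : 'rV[int]_m)
  (xy : (forall i : 'I_m, x 0 i = y 0 i) \/ (forall i : 'I_m, x 0 i <> y 0 i)) :
  let one : 'rV[int]_m := const_mx 1 in
  dAM d x y = D_of (f_add f) x y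
  /\ dGM d x y >= D_of (f_mul f) x y
  /\ dHM d x y >= D_of (f_harm f) x y
  /\ (dAM d one x <= dAM d one y <-> f_add f x <= f_add f y)
  /\ (dGM d one x <= dGM d one y <-> f_mul f x <= f_mul f y)
  /\ (dHM d one x <= dHM d one y <-> f_harm f x <= f_harm f y).
Proof.
move=> one.
have d1E a : d 1 a = f a.
  (* [dE] is silent at [a = 1], where both sides are 0. *)
  case: (eqVneq 1 a) => [<-|/eqP/dE ->]; last by rewrite f1 add0r.
  by rewrite f1 (pseudometric_xx d_pseudo).
have d1 z : (fun i => d (one 0 i) (z 0 i)) =1 (fun i => f (z 0 i)).
  by move=> i; rewrite mxE d1E.
have AM1 z : dAM d one z = f_add f z by exact: eq_arith_mean.
have GM1 z : dGM d one z = f_mul f z by exact: eq_geom_mean.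
have HM1 z : dHM d one z = f_harm f z by exact: eq_harm_mean.
rewrite !AM1 !GM1 !HM1 /D_of.
case: xy => [x_eq_y|x_neq_y].
  have -> : x = y by apply/rowP.
  have d0 : (fun i => d (y 0 i) (y 0 i)) =1 fun=> 0.
    by move=> i; rewrite (pseudometric_xx d_pseudo).
  rewrite eqxx /dAM /dGM /dHM (eq_arith_mean d0) (eq_geom_mean d0).
  by rewrite (eq_harm_mean d0) arith_mean_cst // geom_mean_cst0 // harm_mean_cst0.
have dxy : (fun i => d (x 0 i) (y 0 i)) =1 fun i => f (x 0 i) + f (y 0 i).
  by move=> i; apply: dE.
(* Coordinatewise distinctness yields [x != y] only through an actual index, which [m_gt0]
   supplies. *)
have /negPf -> : x != y.
  by apply/eqP => xy_eq; apply: (x_neq_y (Ordinal m_gt0)); rewrite xy_eq.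
rewrite /dAM /dGM /dHM (eq_arith_mean dxy) (eq_geom_mean dxy) (eq_harm_mean dxy).
rewrite arith_meanD; do ![split] => //; first exact: geom_mean_superadd.
exact: harm_mean_superadd.
Qed.
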